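(* Let $\mathcal{M}=\mathcal{M}_1\times\cdots\times\mathcal{M}_b$ where each $\mathcal{M}_i\subset\mathbb{R}^{n_i}$ is closed and non-empty, and let $F:\mathbb{R}^{n_1+\cdots+n_b}\to\mathbb{R}$ be differentiable with level set $\{\boldsymbol{x}: F(\boldsymbol{x})\le\gamma\}$ bounded for every $\gamma\in\mathbb{R}$. Assume that for every $i\in\{1,\dots,b\}$ and every choice of $\boldsymbol{x}_j\in\mathcal{M}_j$ ($j\ne i$), the problem $$\min_{\boldsymbol{\xi}\in\mathcal{M}_i}F(\boldsymbol{x}_{1:i-1},\boldsymbol{\xi},\boldsymbol{x}_{i+1:b})$$ has a unique global minimizer. Let $\boldsymbol{x}^0\in\mathcal{M}$ and let $\{\boldsymbol{x}^t\}_{t\ge 0}\subset\mathcal{M}$ be the sequence generated by cyclic block exact minimization: for $t=0,1,2,\dots$ and, successively, $i=1,\dots,b$, $$\boldsymbol{x}_i^{t+1}\in\operatorname*{argmin}_{\boldsymbol{\xi}\in\mathcal{M}_i}F(\boldsymbol{x}^{t+1}_1,\dots,\boldsymbol{x}^{t+1}_{i-1},\boldsymbol{\xi},\boldsymbol{x}^t_{i+1},\dots,\boldsymbol{x}^t_b).$$ Then the sequence $\{\boldsymbol{x}^t\}_t$ is bounded and has limit points. Moreover, every limit point is a stationary point of the problem $\min_{\boldsymbol{x}\in\mathcal{M}}F(\boldsymbol{x})$.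
   Context: Notation: a vector $\boldsymbol{x}\in\mathbb{R}^{n_1+\cdots+n_b}$ is written in blocks $\boldsymbol{x}=[\boldsymbol{x}_1;\dots;\boldsymbol{x}_b]=\boldsymbol{x}_{1:b}$ with $\boldsymbol{x}_i\in\mathbb{R}^{n_i}$; $\boldsymbol{x}_{i:j}$ denotes the concatenation of blocks $i,\dots,j$ (empty if $i>j$). A limit point of a sequence is the limit of some convergent subsequence. Tangent cone: for a non-empty closed set $S\subset\mathbb{R}^n$ and $\boldsymbol{a}\in S$, a vector $\boldsymbol{v}$ is a tangent direction at $\boldsymbol{a}$ for $S$ if there are sequences $\{\boldsymbol{a}_j\}_j\subset S$ and $\{\lambda_j\}_j\subset(0,\infty)$ with $\boldsymbol{a}_j\to\boldsymbol{a}$, $\lambda_j\to0$ and $(\boldsymbol{a}_j-\boldsymbol{a})/\lambda_j\to\boldsymbol{v}$. The tangent cone $T_S(\boldsymbol{a})$ is the set of all such tangent directions. Stationary point: $\boldsymbol{x}\in\mathcal{M}$ is a stationary point of $\min_{\boldsymbol{x}\in\mathcal{M}}F(\boldsymbol{x})$ if $\langle\nabla F(\boldsymbol{x}),\boldsymbol{v}\rangle\ge0$ for all $\boldsymbol{v}\in T_{\mathcal{M}}(\boldsymbol{x})$, where $\nabla F$ is the Euclidean gradient and $\langle\cdot,\cdot\rangle$ the Euclidean inner product. *)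

(* Defs.v *)
(* MathComp-Analysis over an arbitrary realType R. *)
From HB Require Import structures.
From mathcomp Require Import all_boot all_order all_algebra.
From mathcomp Require Import all_classical all_reals all_analysis.

Set Implicit Arguments.
Unset Strict Implicit.
Unset Printing Implicit Defensive.

Import Order.TTheory GRing.Theory Num.Theory.
Import numFieldNormedType.Exports.

Local Open Scope classical_set_scope.
Local Open Scope ring_scope.

(* Vectors are row vectors.  A vector with blocks of sizes n i, i : 'I_b, lives
   in 'rV_(\sum_i n i); its i-th block is submxrow x i, and \mxrow_i x_ i is the
   concatenation of the blocks x_ i.  Matrix types carry the sup norm, which is
   equivalent to the Euclidean one; the Euclidean inner product is explicit. *)

Definition inner (R : realType) (N : nat) (u v : 'rV[R]_N) : R :=
  \sum_(k < N) u ord0 k * v ord0 k.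

Definition gradient (R : realType) (N : nat) (F : 'rV[R]_N -> R) (x : 'rV[R]_N) :
  'rV[R]_N := \row_(k < N) 'D_(delta_mx ord0 k) F x.

Definition tangent_cone (R : realType) (N : nat) (S : set 'rV[R]_N)
    (a : 'rV[R]_N) : set 'rV[R]_N :=
  [set v | exists (s : nat -> 'rV[R]_N) (lambda : nat -> R),
    [/\ forall j, S (s j),
        forall j, 0 < lambda j,
        s j @[j --> \oo] --> a,
        lambda j @[j --> \oo] --> (0 : R)
      & (lambda j)^-1 *: (s j - a) @[j --> \oo] --> v]].

Definition stationary (R : realType) (N : nat) (F : 'rV[R]_N -> R)
    (S : set 'rV[R]_N) (x : 'rV[R]_N) : Prop :=
  S x /\ forall v, tangent_cone S x v -> 0 <= inner (gradient F x) v.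

(* This is not the library's [limit_point], which concerns sets: a sequence
   that is eventually constant has a limit point in the present sense. *)
Definition seq_limit_point (R : realType) (N : nat) (x : nat -> 'rV[R]_N)
    (l : 'rV[R]_N) : Prop :=
  exists2 phi : nat -> nat, increasing_seq phi & x (phi k) @[k --> \oo] --> l.

Definition argmin (R : realType) (T : Type) (S : set T) (G : T -> R) : set T :=
  [set a | S a /\ forall y, S y -> G a <= G y].

Definition block_product (R : realType) (b : nat) (n : 'I_b -> nat)
    (M : forall i : 'I_b, set 'rV[R]_(n i)) : set 'rV[R]_(\sum_i n i) :=
  [set x | forall i, M i (submxrow x i)].

(* (x_1, ..., x_(i-1), xi, x_(i+1), ..., x_b) *)
Definition set_block (R : realType) (b : nat) (n : 'I_b -> nat)
    (x : 'rV[R]_(\sum_i n i)) (i : 'I_b) (xi : 'rV[R]_(n i)) :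
    'rV[R]_(\sum_i n i) :=
  \mxrow_j eqtype.dfwith (fun k => submxrow x k) xi j.

(* (y_1, ..., y_(i-1), x_i, x_(i+1), ..., x_b) *)
Definition mix_blocks (R : realType) (b : nat) (n : 'I_b -> nat)
    (y x : 'rV[R]_(\sum_i n i)) (i : 'I_b) : 'rV[R]_(\sum_i n i) :=
  \mxrow_j (if (j < i)%N then submxrow y j else submxrow x j).

Definition cyclic_exact_minimization (R : realType) (b : nat) (n : 'I_b -> nat)
    (F : 'rV[R]_(\sum_i n i) -> R) (M : forall i : 'I_b, set 'rV[R]_(n i))
    (x : nat -> 'rV[R]_(\sum_i n i)) : Prop :=
  forall (t : nat) (i : 'I_b),
    argmin (M i) (fun xi => F (set_block (mix_blocks (x t.+1) (x t) i) xi))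
      (submxrow (x t.+1) i).

(* Main.v *)
Require Import Defs.
From HB Require Import structures.
From mathcomp Require Import all_boot all_order all_algebra.
From mathcomp Require Import all_classical all_reals all_analysis.

Set Implicit Arguments.
Unset Strict Implicit.
Unset Printing Implicit Defensive.

Import Order.TTheory GRing.Theory Num.Theory.
Import numFieldNormedType.Exports.

Local Open Scope classical_set_scope.
Local Open Scope ring_scope.

(** During the sweep from [x t] to [x t.+1] the algorithm visits the points
    z_k whose first k blocks are those of [x t.+1] and whose other blocks are
    those of [x t].  Each step is an exact minimization in which the old block
    is admissible, so F(x t.+1) <= F(z_k) <= F(x t).  Hence the sequence stays
    in the sublevel set of F(x 0), which is compact; this gives boundedness and a
    limit point.

    Let l be the limit of a subsequence.  Since F(x t) is nonincreasing, the
    whole sequence F(x t) converges to F(l), and so does F(z_k) for each fixed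
    k.  Choose an ultrafilter U on the indices, finer than the filter of the
    tails of the subsequence.  Along U the points x t converge to l and, by
    compactness, every sequence in the sublevel set converges.  By induction on
    k, z_k converges to l along U ([ultra_argmin_block]): if z_k does, the
    block computed at the next step, block k counting from 0, has a limit q,
    which minimizes F over M_k when the other blocks are those of l, and F
    takes the value F(l) there; so the k-th block of l is a minimizer too, and
    uniqueness of the minimizer makes it equal to q. Ultrafilters replace the
    repeated extraction of subsequences. As a by-product, each block of l
    minimizes F over M_i with the other blocks of l fixed.

    Such a blockwise minimizer is stationary ([argmin_block_stationary]).  Given
    s_k in M with (s_k - l) / lambda_k tending to v, replacing the i-th block of
    l by that of s_k shows that the differential of F at l is nonnegative
    at the vector v_i that agrees with v on block i and vanishes elsewhere;
    summing over i gives the claim for v. *)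

(** * Subsequences and ultrafilters *)

Lemma cvg_subsequence_of_cluster (R : realType) (T : pseudoMetricType R)
    (u : nat -> T) (l : T) :
  cluster (u @ \oo) l ->
  exists2 phi : nat -> nat, increasing_seq phi & u (phi k) @[k --> \oo] --> l.
Proof.
move=> ul.
have next (k N : nat) : {m : nat | (N < m)%N /\ ball l k.+1%:R^-1 (u m)}.
  apply/cid; have [||y [[m /= Nm <-] lm]] := ul (u @` [set m | (N < m)%N])
      (ball l k.+1%:R^-1).
  - by exists N.+1 => // m /= Nm; exists m.
  - by apply: nbhsx_ballx; rewrite invr_gt0 ltr0n.
  - by exists m.
(* [u (phi k)] lies in the ball of radius 1/(k+1) around l, and each index is
   chosen beyond the preceding one. *)
pose phi := fix phi k := if k is k'.+1 then sval (next k (phi k')) else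
  sval (next 0%N 0%N).
have phi_ball k : ball l k.+1%:R^-1 (u (phi k)).
  by case: k => [|k] /=; case: (next _ _) => m [].
exists phi.
  by apply/increasing_seqP => k /=; case: (next _ _) => m [].
apply/cvg_ballP => e e0; near=> k.
apply: le_ball (phi_ball k); near: k.
have := near_infty_natSinv_lt (PosNum e0).
by apply: filterS => k /ltW.
Unshelve. all: by end_near. Qed.

(** No surjectivity of [f] is needed, since [f @ U] consists of the sets whose
    preimage is in [U], not of the images of the sets of [U]. *)
Lemma ultrafilter_fmap (S T : Type) (f : S -> T) (U : set_system S) :
  UltraFilter U -> UltraFilter (f @ U).
Proof.
move=> UU; split=> [|G GF sUG]; first exact: fmap_proper_filter.
rewrite predeqE => A; split=> [GA|]; last exact: sUG.
have [//|UnA] := in_ultra_setVsetC (f @^-1` A) UU.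
have GnA : G (~` A) by apply: sUG.
by have /filter_ex [y []] : G (A `&` ~` A) by exact: filterI.
Qed.

Lemma increasing_seq_ge (phi : nat -> nat) :
  increasing_seq phi -> forall k, (k <= phi k)%N.
Proof.
move=> phi_incr; elim=> // k /leq_ltn_trans; apply.
by move/increasing_seqP: phi_incr; exact.
Qed.

Lemma nonincreasing_cvg_subseq (R : realType) (a : nat -> R) (phi : nat -> nat)
    (c : R) :
  nonincreasing_seq a -> increasing_seq phi -> a (phi k) @[k --> \oo] --> c ->
  a @ \oo --> c.
Proof.
move=> amon phi_incr ac.
have phi_ge := increasing_seq_ge phi_incr.
have apmon : nonincreasing_seq (a \o phi).
  by move=> i j ij; apply: amon; rewrite -leEnat phi_incr.
have a_ge t : c <= a t.
  apply: le_trans (amon _ _ (phi_ge t)).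
  have := @nonincreasing_cvgn_ge _ _ apmon (cvgP _ ac) t.
  by rewrite (cvg_lim _ ac).
apply/cvgrPdist_le => e e0; move/cvgrPdist_le: ac => /(_ _ e0)[N _ acN].
exists (phi N) => // t /= Nt.
have := acN N (leqnn _).
rewrite !(distrC c) !ger0_norm ?subr_ge0//; apply: le_trans.
by rewrite lerD2r; exact: amon.
Qed.

(** * Convergence of block vectors *)

Lemma cvg_mx (R : topologicalType) (T : Type) (G : set_system T)
    {GF : Filter G} (m n : nat)
    (f : T -> 'M[R]_(m, n)) (l : 'M[R]_(m, n)) :
  (forall i j, f t i j @[t --> G] --> l i j) ->
  f t @[t --> G] --> l.
Proof.
move=> fl A [P lP PA]; apply: filterS PA _.
have := @filter_forall _ _ _ _ GF (fun i => @filter_forall _ _ _ _ GF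
  (fun j => fl i j _ (lP i j))).
exact.
Qed.

Lemma cvg_submxrow (R : numFieldType) (T : Type) (G : set_system T)
    {GF : Filter G} (b : nat) (n : 'I_b -> nat)
    (f : T -> 'rV[R]_(\sum_i n i))
    (l : 'rV[R]_(\sum_i n i)) (i : 'I_b) :
  f t @[t --> G] --> l ->
  submxrow (f t) i @[t --> G] --> submxrow l i.
Proof.
move=> fl; apply: cvg_mx => j k; rewrite mxE.
under eq_fun do rewrite mxE.
exact: (cvg_comp _ _ fl (@coord_continuous _ _ _ _ _ _)).
Qed.

Lemma cvg_mxrow (R : numFieldType) (T : Type) (G : set_system T)
    {GF : Filter G} (b : nat) (n : 'I_b -> nat)
    (f : forall i : 'I_b, T -> 'rV[R]_(n i))
    (l : forall i : 'I_b, 'rV[R]_(n i)) :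
  (forall i, f i t @[t --> G] --> l i) ->
  \mxrow_i f i t @[t --> G] --> \mxrow_i l i.
Proof.
move=> fl; apply: cvg_mx => j k; rewrite mxE.
under eq_fun do rewrite mxE.
exact: (cvg_comp _ _ (fl _) (@coord_continuous _ _ _ _ _ _)).
Qed.

Lemma cvg_set_block (R : realType) (T : Type) (G : set_system T)
    {GF : Filter G} (b : nat)
    (n : 'I_b -> nat) (i : 'I_b) (f : T -> 'rV[R]_(\sum_i n i))
    (l : 'rV[R]_(\sum_i n i)) (g : T -> 'rV[R]_(n i)) (w : 'rV[R]_(n i)) :
  f t @[t --> G] --> l -> g t @[t --> G] --> w ->
  set_block (f t) (g t) @[t --> G] --> set_block l w.
Proof.
move=> fl gw; apply: cvg_mxrow => j; have [<-|ij] := eqVneq i j.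
  by rewrite dfwith_in; under eq_fun do rewrite dfwith_in.
rewrite dfwith_out//; under eq_fun do rewrite dfwith_out//.
exact: cvg_submxrow.
Qed.

(** * Algebra of blocks *)

Lemma submxrow_set_block (R : realType) (b : nat) (n : 'I_b -> nat)
    (x : 'rV[R]_(\sum_i n i)) (i : 'I_b) (xi : 'rV[R]_(n i)) :
  submxrow (set_block x xi) i = xi.
Proof. by rewrite mxrowK dfwith_in. Qed.

Lemma set_block_submxrow (R : realType) (b : nat) (n : 'I_b -> nat)
    (x : 'rV[R]_(\sum_i n i)) (i : 'I_b) : set_block x (submxrow x i) = x.
Proof.
rewrite -[RHS]submxrowK; apply: eq_mxrow => j.
by have [<-|ij] := eqVneq i j; rewrite ?dfwith_in// dfwith_out.
Qed.

Lemma sum_set_block_submxrow (R : realType) (b : nat) (n : 'I_b -> nat)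
    (v : 'rV[R]_(\sum_i n i)) :
  \sum_(i < b) (set_block 0 (submxrow v i)) = v.
Proof.
apply/mxrowP => j; rewrite submxrow_sum (bigD1 j)//= submxrow_set_block.
rewrite big1 ?addr0// => i ij.
by rewrite mxrowK dfwith_out// submxrow0.
Qed.

Lemma set_blockB (R : realType) (b : nat) (n : 'I_b -> nat)
    (l : 'rV[R]_(\sum_i n i)) (i : 'I_b) (xi : 'rV[R]_(n i)) :
  set_block l xi - l = set_block 0 (xi - submxrow l i).
Proof.
apply/mxrowP => j; rewrite submxrowB !mxrowK.
have [<-|ij] := eqVneq i j; first by rewrite !dfwith_in.
by rewrite !dfwith_out// subrr submxrow0.
Qed.

Lemma set_block0Z (R : realType) (b : nat) (n : 'I_b -> nat) (c : R)
    (i : 'I_b) (xi : 'rV[R]_(n i)) :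
  set_block (0 : 'rV[R]_(\sum_i n i)) (c *: xi) = c *: set_block 0 xi.
Proof.
apply/mxrowP => j.
have submxrowZ (y : 'rV[R]_(\sum_i n i)) :
    submxrow (c *: y) j = c *: submxrow y j.
  by apply/rowP => k; rewrite !mxE.
rewrite submxrowZ !mxrowK.
have [<-|ij] := eqVneq i j; first by rewrite !dfwith_in.
by rewrite !dfwith_out// submxrow0 scaler0.
Qed.

(** The first [k] blocks come from [y], the others from [x].  The index [k]
    is a natural number, so that [k = b], a completed sweep, is allowed; when
    [k] is an ordinal [i], this is [mix_blocks y x i] by conversion. *)
Definition prefix_mix (R : realType) (b : nat) (n : 'I_b -> nat)
    (y x : 'rV[R]_(\sum_i n i)) (k : nat) : 'rV[R]_(\sum_i n i) :=
  \mxrow_j (if (j < k)%N then submxrow y j else submxrow x j).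

Lemma prefix_mix0 (R : realType) (b : nat) (n : 'I_b -> nat)
    (y x : 'rV[R]_(\sum_i n i)) : prefix_mix y x 0 = x.
Proof. exact: submxrowK. Qed.

Lemma prefix_mix_full (R : realType) (b : nat) (n : 'I_b -> nat)
    (y x : 'rV[R]_(\sum_i n i)) (k : nat) : (b <= k)%N -> prefix_mix y x k = y.
Proof.
move=> bk; rewrite -[RHS]submxrowK; apply: eq_mxrow => j.
by rewrite (leq_trans (ltn_ord j) bk).
Qed.

Lemma set_block_prefix_mixr (R : realType) (b : nat) (n : 'I_b -> nat)
    (y x : 'rV[R]_(\sum_i n i)) (i : 'I_b) :
  set_block (prefix_mix y x i) (submxrow x i) = prefix_mix y x i.
Proof.
rewrite -[in LHS](_ : submxrow (prefix_mix y x i) i = submxrow x i).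
  exact: set_block_submxrow.
by rewrite mxrowK ltnn.
Qed.

Lemma set_block_prefix_mixl (R : realType) (b : nat) (n : 'I_b -> nat)
    (y x : 'rV[R]_(\sum_i n i)) (i : 'I_b) :
  set_block (prefix_mix y x i) (submxrow y i) = prefix_mix y x i.+1.
Proof.
apply: eq_mxrow => j; have [<-|ij] := eqVneq i j.
  by rewrite dfwith_in ltnSn.
rewrite dfwith_out// mxrowK; suff -> : (j < i.+1)%N = (j < i)%N by [].
by rewrite ltnS leq_eqVlt val_eqE [j == i]eq_sym (negbTE ij).
Qed.

(** * Blockwise minimizers are stationary *)

(** The difference quotients of F along a sequence defining a tangent direction
    converge to the differential in that direction. *)
Lemma differential_tangent_cvg (R : realType) (V : normedModType R)
    (F : V -> R) (a v : V) (s : nat -> V) (lambda : nat -> R) :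
  differentiable F a -> (forall k, 0 < lambda k) -> s k @[k --> \oo] --> a ->
  (lambda k)^-1 *: (s k - a) @[k --> \oo] --> v ->
  (lambda k)^-1 * (F (s k) - F a) @[k --> \oo] --> 'd F a v.
Proof.
move=> dF lambda0 sa sv.
(* The remainder of the first-order expansion is o(h). *)
pose e h := F (a + h) - F a - 'd F a h.
have oe (c : R) : 0 < c -> \forall h \near (0 : V), `|e h| <= c * `|h|.
  move=> c0; have /eqaddoP /(_ _ c0) := diff_locally dF.
  apply: filterS => h /=.
  rewrite /e !fctE /= opprD addrA [h + a]addrC; exact.
have sa0 : s k - a @[k --> \oo] --> (0 : V).
  by rewrite -(subrr a); apply: cvgB => //; exact: cvg_cst.
have rem0 : (lambda k)^-1 * e (s k - a) @[k --> \oo] --> (0 : R).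
  apply/cvgr0Pnorm_le => c c0.
  have [M M0 vM] : exists2 M : R, 0 < M & \forall k \near \oo,
      `|(lambda k)^-1 *: (s k - a)| <= M.
    exists (`|v| + 1); first by rewrite ltr_pwDr.
    by apply: (cvgr_norm_le _ sv); rewrite ltrDl.
  have := sa0 _ (oe _ (divr_gt0 c0 M0)); rewrite /= nbhs_simpl => ek.
  near=> k.
  have ek1 : `|e (s k - a)| <= c / M * `|s k - a| by near: k; exact: ek.
  have vk : `|(lambda k)^-1 *: (s k - a)| <= M by near: k.
  have lk : 0 < (lambda k)^-1 by rewrite invr_gt0.
  rewrite normrM (gtr0_norm lk).
  rewrite (le_trans (ler_wpM2l (ltW lk) ek1))// mulrCA.
  rewrite -[leRHS](divfK (lt0r_neq0 M0)) ler_wpM2l ?(ltW (divr_gt0 c0 M0))//.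
  by move: vk; rewrite normrZ (gtr0_norm lk).
have -> : (fun k => (lambda k)^-1 * (F (s k) - F a)) = fun k =>
    'd F a ((lambda k)^-1 *: (s k - a)) + (lambda k)^-1 * e (s k - a).
  apply/funext => k; rewrite linearZ /= -[_ *: _]/(_ * _) -mulrDr.
  by congr (_ * _); rewrite /e [a + _]addrC subrK [RHS]addrC subrK.
rewrite -['d F a v]addr0; apply: cvgD => //; apply: (cvg_comp _ _ sv).
exact: (diff_continuous dF).
Unshelve. all: by end_near. Qed.

Lemma inner_gradientE (R : realType) (N : nat) (F : 'rV[R]_N -> R) x v :
  differentiable F x -> inner (gradient F x) v = 'd F x v.
Proof.
move=> dF; rewrite [v in RHS]matrix_sum_delta big_ord1 linear_sum.
by apply: eq_bigr => k _; rewrite linearZ /= mxE deriveE// mulrC.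
Qed.

Lemma argmin_block_stationary (R : realType) (b : nat) (n : 'I_b -> nat)
    (M : forall i : 'I_b, set 'rV[R]_(n i))
    (F : 'rV[R]_(\sum_i n i) -> R) (l : 'rV[R]_(\sum_i n i)) :
  differentiable F l ->
  (forall i, argmin (M i) (fun xi => F (set_block l xi)) (submxrow l i)) ->
  stationary F (block_product M) l.
Proof.
move=> dF lmin; split=> [i|v [s [lambda [Ms lambda0 sl _ sv]]]].
  by have [] := lmin i.
rewrite inner_gradientE// -(sum_set_block_submxrow v) linear_sum.
apply: sumr_ge0 => i _.
have sil : set_block l (submxrow (s k) i) @[k --> \oo] --> l.
  rewrite -[X in _ --> X](set_block_submxrow l i).
  by apply: cvg_set_block; [exact: cvg_cst|exact: cvg_submxrow].
have siv : (lambda k)^-1 *: (set_block l (submxrow (s k) i) - l) @[k --> \oo]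
    --> set_block (0 : 'rV[R]_(\sum_i n i)) (submxrow v i).
  rewrite [X in X @ _](_ : _ = fun k => set_block (0 : 'rV[R]_(\sum_i n i))
    ((lambda k)^-1 *: (submxrow (s k) i - submxrow l i))); last first.
    by apply/funext => k; rewrite set_block0Z -set_blockB.
  apply: cvg_set_block; first exact: cvg_cst.
  rewrite [X in X @ _](_ : _ =
    fun k => submxrow ((lambda k)^-1 *: (s k - l)) i);
    first exact: cvg_submxrow.
  by apply/funext => k; apply/rowP => j; rewrite !mxE.
apply: (cvgr_to_ge (differential_tangent_cvg dF lambda0 sil siv)).
apply: filterE => k; rewrite mulr_ge0 ?invr_ge0 ?(ltW (lambda0 k))// subr_ge0.
by have [_ /(_ _ (Ms k i))] := lmin i; rewrite set_block_submxrow.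
Qed.

(** * Limits of exact block minimizers *)

Lemma compact_sublevel (R : realType) (N : nat) (F : 'rV[R]_N -> R) (c : R) :
  continuous F -> bounded_set [set y | F y <= c] -> compact [set y | F y <= c].
Proof.
move=> Fcont Fbnd; apply: bounded_closed_compact => //.
exact: (@preimage_closed _ _ F [set r | r <= c]).
Qed.

(** One step of the induction along a sweep.  Here [z t] is the point before
    block [i] is minimized and [set_block (z t) (w t)] the point after.  The
    conclusion says that the limit [l] is preserved by the step, and that its
    block [i] is optimal. *)
Lemma ultra_argmin_block (R : realType) (b : nat) (n : 'I_b -> nat)
    (I : Type) (U : set_system I) (F : 'rV[R]_(\sum_i n i) -> R) (i : 'I_b)
    (A : set 'rV[R]_(n i)) (K : set 'rV[R]_(\sum_i n i))
    (z : I -> 'rV[R]_(\sum_i n i)) (w : I -> 'rV[R]_(n i))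
    (l : 'rV[R]_(\sum_i n i)) :
  UltraFilter U -> continuous F -> closed A -> compact K ->
  (forall t, argmin A (fun xi => F (set_block (z t) xi)) (w t)) ->
  (forall t, K (set_block (z t) (w t))) ->
  A (submxrow l i) ->
  (forall a a', argmin A (fun xi => F (set_block l xi)) a ->
    argmin A (fun xi => F (set_block l xi)) a' -> a = a') ->
  z t @[t --> U] --> l ->
  F (set_block (z t) (w t)) @[t --> U] --> F l ->
  argmin A (fun xi => F (set_block l xi)) (submxrow l i) /\
  set_block (z t) (w t) @[t --> U] --> l.
Proof.
move=> UU Fcont Acl Kco wmin Kzw Al uniq zl Fzw.
have [p [_ zwp]] :
    K `&` [set p | set_block (z t) (w t) @[t --> U] --> p] !=set0.
  move: Kco; rewrite compact_ultra; apply; first exact: ultrafilter_fmap.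
  by apply: (@filterE _ U) => t; exact: Kzw.
pose q := submxrow p i.
have wq : w t @[t --> U] --> q.
  rewrite (_ : w = fun t => submxrow (set_block (z t) (w t)) i).
    exact: cvg_submxrow.
  by apply/funext => t; rewrite submxrow_set_block.
have zwlq : set_block (z t) (w t) @[t --> U] --> set_block l q.
  exact: cvg_set_block.
have Aq : A q.
  by apply: (closed_cvg A Acl _ _ wq); apply: filterE => t; have [] := wmin t.
(* The limit of the values identifies F at q with F(l), so q and the block of l
   are both optimal. *)
have Flq : F (set_block l q) = F l.
  have Fzw' := cvg_comp _ _ zwlq (Fcont _).
  exact: (cvg_unique (@Rhausdorff R) Fzw' Fzw).
have qmin : argmin A (fun xi => F (set_block l xi)) q.
  split=> // xi Axi; rewrite Flq.
  have zxi : F (set_block (z t) xi) @[t --> U] --> F (set_block l xi).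
    have zlxi : set_block (z t) xi @[t --> U] --> set_block l xi.
      by apply: cvg_set_block => //; exact: cvg_cst.
    exact: (cvg_comp _ _ zlxi (Fcont _)).
  rewrite -subr_ge0; apply: (cvgr_to_ge (cvgB zxi Fzw)).
  apply: nearW => t; rewrite subr_ge0.
  by have [_] := wmin t; apply.
have lmin : argmin A (fun xi => F (set_block l xi)) (submxrow l i).
  split=> // xi Axi; rewrite set_block_submxrow -Flq; exact: qmin.2.
split=> //.
by move: zwlq; rewrite (uniq _ _ qmin lmin) set_block_submxrow.
Qed.

(** * Cyclic exact minimization *)

Lemma cyclic_in_block_product (R : realType) (b : nat) (n : 'I_b -> nat)
    (M : forall i : 'I_b, set 'rV[R]_(n i)) (F : 'rV[R]_(\sum_i n i) -> R)
    (x : nat -> 'rV[R]_(\sum_i n i)) :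
  block_product M (x 0%N) -> cyclic_exact_minimization F M x ->
  forall t, block_product M (x t).
Proof. by move=> x0_in x_gen [//|t] i; have [] := x_gen t i. Qed.

(** The objective does not increase along the intermediate points of a sweep:
    the old block i of [x t] competes in the i-th block minimization. *)
Lemma cyclic_prefix_mix_nonincreasing (R : realType) (b : nat) (n : 'I_b -> nat)
    (M : forall i : 'I_b, set 'rV[R]_(n i)) (F : 'rV[R]_(\sum_i n i) -> R)
    (x : nat -> 'rV[R]_(\sum_i n i)) :
  block_product M (x 0%N) -> cyclic_exact_minimization F M x ->
  forall t, nonincreasing_seq (fun k => F (prefix_mix (x t.+1) (x t) k)).
Proof.
move=> x0_in x_gen t; apply/nonincreasing_seqP => k.
have [kb|bk] := ltnP k b; last by rewrite !prefix_mix_full// leqW.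
have [_] := x_gen t (Ordinal kb).
move=> /(_ _ (cyclic_in_block_product x0_in x_gen t _)).
by rewrite set_block_prefix_mixl set_block_prefix_mixr.
Qed.

Lemma cyclic_prefix_mix_bounds (R : realType) (b : nat) (n : 'I_b -> nat)
    (M : forall i : 'I_b, set 'rV[R]_(n i)) (F : 'rV[R]_(\sum_i n i) -> R)
    (x : nat -> 'rV[R]_(\sum_i n i)) :
  block_product M (x 0%N) -> cyclic_exact_minimization F M x ->
  forall t k, F (x t.+1) <= F (prefix_mix (x t.+1) (x t) k) <= F (x t).
Proof.
move=> x0_in x_gen t k.
have mon := cyclic_prefix_mix_nonincreasing x0_in x_gen t.
have := mon _ _ (leq_maxr b k); have := mon _ _ (leq0n k).
by rewrite prefix_mix0 (prefix_mix_full _ _ (leq_maxl b k)) => -> ->.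
Qed.

Lemma cyclic_nonincreasing (R : realType) (b : nat) (n : 'I_b -> nat)
    (M : forall i : 'I_b, set 'rV[R]_(n i)) (F : 'rV[R]_(\sum_i n i) -> R)
    (x : nat -> 'rV[R]_(\sum_i n i)) :
  block_product M (x 0%N) -> cyclic_exact_minimization F M x ->
  nonincreasing_seq (F \o x).
Proof.
move=> x0_in x_gen; apply/nonincreasing_seqP => t /=.
by have /andP[] := cyclic_prefix_mix_bounds x0_in x_gen t 0; exact: le_trans.
Qed.

(** Uniqueness of the block minimizers is needed only at the limit point. *)
Lemma cyclic_limit_stationary (R : realType) (b : nat) (n : 'I_b -> nat)
    (M : forall i : 'I_b, set 'rV[R]_(n i)) (F : 'rV[R]_(\sum_i n i) -> R)
    (x : nat -> 'rV[R]_(\sum_i n i))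
    (l : 'rV[R]_(\sum_i n i)) :
  block_product M (x 0%N) -> cyclic_exact_minimization F M x ->
  (forall i : 'I_b, closed (M i)) -> (forall y, differentiable F y) ->
  bounded_set [set y | F y <= F (x 0%N)] ->
  (block_product M l -> forall (i : 'I_b) a a',
     argmin (M i) (fun xi => F (set_block l xi)) a ->
     argmin (M i) (fun xi => F (set_block l xi)) a' -> a = a') ->
  seq_limit_point x l -> stationary F (block_product M) l.
Proof.
move=> x0_in x_gen Mcl dF Fbnd uniq [phi phi_incr xl].
have Fcont : continuous F by move=> y; exact: differentiable_continuous.
have Ml : block_product M l.
  move=> j.
  have xlj : submxrow (x (phi k)) j @[k --> \oo] --> submxrow l j.
    exact: cvg_submxrow.
  apply: (closed_cvg (M j) (Mcl j) _ _ xlj).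
  by apply: nearW => k; exact: cyclic_in_block_product x0_in x_gen _ _.
have Fx : F (x t) @[t --> \oo] --> F l.
  apply: (nonincreasing_cvg_subseq (cyclic_nonincreasing x0_in x_gen) phi_incr).
  exact: (cvg_comp _ _ xl (Fcont l)).
have FxS : F (x t.+1) @[t --> \oo] --> F l by rewrite (cvg_shiftS (F \o x)).
have Kco : compact [set y | F y <= F (x 0%N)] by exact: compact_sublevel.
have [U [UU phiU]] :=
  ultraFilterLemma (fmap_proper_filter phi eventually_filter).
(* U is finer than the filter of tails of nat, hence it preserves the limits of
   whole sequences, and not only of the subsequence. *)
have ooU : \oo `<=` U.
  move=> A ooA; apply: phiU.
  case: ooA => N _ NA; exists N => // k /= Nk; apply: NA => /=.
  exact: leq_trans Nk (increasing_seq_ge phi_incr k).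
have xlU : x t @[t --> U] --> l by move=> A /xl; exact: phiU.
pose z k t := prefix_mix (x t.+1) (x t) k.
have Fz k : F (z k t) @[t --> U] --> F l.
  apply: (@squeeze_cvgr _ _ _ _ (fun t => F (x t.+1)) (fun t => F (x t))).
  - by apply: nearW => t; exact: (cyclic_prefix_mix_bounds x0_in x_gen).
  - by move=> A /FxS; exact: ooU.
  - by move=> A /Fx; exact: ooU.
have step (i : 'I_b) : z i t @[t --> U] --> l ->
    argmin (M i) (fun xi => F (set_block l xi)) (submxrow l i) /\
    z i.+1 t @[t --> U] --> l.
  move=> zl.
  have zS t : set_block (z i t) (submxrow (x t.+1) i) = z i.+1 t.
    exact: set_block_prefix_mixl.
  have Fzi : F (set_block (z i t) (submxrow (x t.+1) i)) @[t --> U] --> F l.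
    rewrite [X in X @ _](_ : _ = fun t => F (z i.+1 t)); first exact: Fz.
    by apply/funext => t; rewrite zS.
  rewrite [X in X @ _ --> l](_ : _ = fun t =>
    set_block (z i t) (submxrow (x t.+1) i)); last first.
    by apply/funext => t; rewrite zS.
  apply: (ultra_argmin_block UU Fcont (Mcl i) Kco (x_gen^~ i)) => //.
  - move=> t /=; rewrite zS.
    have /andP[_ /le_trans] := cyclic_prefix_mix_bounds x0_in x_gen t i.+1.
    by apply; exact: (cyclic_nonincreasing x0_in x_gen).
  - exact: uniq.
have zl k : z k t @[t --> U] --> l.
  elim: k => [|k IHk].
    rewrite [X in X @ _](_ : _ = x)//.
    by apply/funext => t; rewrite /z prefix_mix0.
  have [kb|bk] := ltnP k b; first exact: (step (Ordinal kb) IHk).2.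
  rewrite [X in X @ _](_ : _ = fun t => z k t)//.
  by apply/funext => t; rewrite /z !prefix_mix_full// leqW.
by apply: argmin_block_stationary => // i; exact: (step i (zl i)).1.
Qed.

Theorem theorem1 (R : realType) (b : nat) (n : 'I_b -> nat)
    (M : forall i : 'I_b, set 'rV[R]_(n i))
    (F : 'rV[R]_(\sum_i n i) -> R)
    (x : nat -> 'rV[R]_(\sum_i n i))
    (M_closed : forall i, closed (M i))
    (M_nonempty : forall i, M i !=set0)
    (F_diff : forall y, differentiable F y)
    (F_level : forall gamma : R, bounded_set [set y | F y <= gamma])
    (F_uniq : forall (i : 'I_b) (y : 'rV[R]_(\sum_i n i)),
        (forall j, j != i -> M j (submxrow y j)) ->
        exists! xi, argmin (M i) (fun xi => F (set_block y xi)) xi)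
    (x0_in : block_product M (x 0%N))
    (x_gen : cyclic_exact_minimization F M x) :
  [/\ bounded_set (range x),
      exists l, seq_limit_point x l
    & forall l, seq_limit_point x l -> stationary F (block_product M) l].
Proof.
have Fcont : continuous F by move=> y; exact: differentiable_continuous.
have x_level t : F (x t) <= F (x 0%N).
  by exact: (cyclic_nonincreasing x0_in x_gen).
split.
- have [B [B_real BF]] := F_level (F (x 0%N)).
  by exists B; split=> // r Br _ [t _ <-]; apply: BF => //; exact: x_level.
- have Kco : compact [set y | F y <= F (x 0%N)] by exact: compact_sublevel.
  have [|l [_ xl]] := Kco _ (fmap_proper_filter x eventually_filter).
    by apply: (@filterE _ \oo) => t; exact: x_level.
  by exists l; exact: cvg_subsequence_of_cluster.
- move=> l; apply: (cyclic_limit_stationary x0_in x_gen) => //.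
  move=> Ml i a a' amin amin'.
  have [//|c [_ cu]] := F_uniq i l.
  by rewrite -(cu _ amin) -(cu _ amin').
Qed.
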